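(* Assume that a new component $j$ (a sensor or an actuator) is deployed in the system. Let $\delta(i)$ and $\delta'(i)$ be respectively the security indices of an arbitrary actuator $i$ (already present in the system) before and after the deployment. Then: (1) $\delta(i)\le\delta'(i)\le\delta(i)+1$ if $j$ is an unprotected sensor; (2) $\delta(i)\le\delta'(i)$ if $j$ is a protected sensor; (3) $\delta(i)\ge\delta'(i)$ if $j$ is an actuator.
   Context: System model. Consider the discrete-time linear system, $k\in\mathbb{Z}_{\ge 0}$, $$x(k+1)=Ax(k)+Bu(k)+B_a a(k),\qquad y(k)=Cx(k)+D_a a(k),$$ with state $x(k)\in\mathbb{R}^{n_x}$, control input $u(k)\in\mathbb{R}^{n_u}$, measurements $y(k)\in\mathbb{R}^{n_y+n_e}$, attack vector $a(k)\in\mathbb{R}^{n_u+n_y}$. The first $n_y$ measurements are unprotected sensors; the last $n_e\ge 0$ are protected and cannot be manipulated. The first $n_u$ entries of $a$ are attacks on actuators, the last $n_y$ are attacks on the unprotected sensors, so $$B_a=\begin{bmatrix} B & \mathbf{0}_{n_x\times n_y}\end{bmatrix},\qquad D_a=\begin{bmatrix}\mathbf{0}_{n_y\times n_u} & \mathbf{I}_{n_y}\\ \mathbf{0}_{n_e\times n_u} & \mathbf{0}_{n_e\times n_y}\end{bmatrix}.$$ $B$ has full column rank (both before and after deployment). $\mathcal{I}=\{1,\dots,n_u+n_y\}$, and $a^{(i)}$ is the $i$-th entry of $a$. For a signal $s$, $s\ne 0$ means $s(k)\neq 0$ for at least one $k$. Security index. Let $\|a\|_0=\left|\bigcup_{k\in\mathbb{Z}_{\ge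 0}}\{i\in\mathcal{I}: a^{(i)}(k)\neq 0\}\right|$. For an actuator $i\in\{1,\dots,n_u\}$, $\delta(i)$ is the minimum of $\|a\|_0$ over all signals $a:\mathbb{Z}_{\ge0}\to\mathbb{R}^{n_u+n_y}$ such that, with $x(0)=0$, $x(k+1)=Ax(k)+B_a a(k)$ and $0=Cx(k)+D_a a(k)$ for all $k$, and $a^{(i)}\neq 0$. If there is no such $a$, $\delta(i)=+\infty$. Deployment. Deploying a new sensor means adding one row to $C$ (among the unprotected rows, with a corresponding new attack entry, if it is unprotected; among the protected rows, with no new attack entry, if it is protected). Deploying a new actuator means adding one column to $B$ with a corresponding new attack entry. Everything else is unchanged. *)

(* Defs.v *)
From HB Require Import structures.
From mathcomp Require Import all_boot all_order all_algebra.
From mathcomp Require Import boolp constructive_ereal reals.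
Set Implicit Arguments.
Unset Strict Implicit.
Unset Printing Implicit Defensive.
Import Order.TTheory GRing.Theory Num.Theory.
Local Open Scope ring_scope.

(* The ny unprotected rows of C come first, the ne protected ones last; the
   first nu entries of an attack act on actuators, the last ny on sensors. *)
Section SecurityIndex.
Variables (R : realType) (nx nu ny ne : nat).
Implicit Types (A : 'M[R]_nx) (B : 'M[R]_(nx, nu)) (C : 'M[R]_(ny + ne, nx)).

Definition attack_signal := nat -> 'cV[R]_(nu + ny).
Implicit Types a : attack_signal.

Definition Ba B : 'M[R]_(nx, nu + ny) := row_mx B 0.

Definition Da : 'M[R]_(ny + ne, nu + ny) := block_mx 0 1%:M 0 0.

Definition attack_support a : {set 'I_(nu + ny)} :=
  [set i | `[< exists k : nat, a k i 0 != 0 >]].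

Definition attack_norm0 a : nat := #|attack_support a|.

Definition undetectable A B C a : Prop :=
  exists x : nat -> 'cV[R]_nx,
    x 0%N = 0 /\
    forall k : nat,
      x k.+1 = A *m x k + Ba B *m a k /\ 0 = C *m x k + Da *m a k.

Definition index_candidate A B C (i : 'I_nu) : pred nat := fun n =>
  `[< exists a : attack_signal,
        [/\ undetectable A B C a,
            exists k : nat, a k (lshift ny i) 0 != 0
          & attack_norm0 a = n] >].

Definition security_index A B C (i : 'I_nu) : \bar R :=
  match pselect (exists n : nat, index_candidate A B C i n) with
  | left ex => ((ex_minn ex)%:R)%:E
  | right _ => +oo%E
  end.

End SecurityIndex.

(* In the three relations below, the primed matrix is the one after the
   deployment, and p is the position of the inserted row or column. *)
Definition deploy_unprotected_sensor (R : realType) (nx ny ne : nat)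
    (p : 'I_ny.+1) (C : 'M[R]_(ny + ne, nx)) (C' : 'M[R]_(ny.+1 + ne, nx)) :=
  row' p (usubmx C') = usubmx C /\ dsubmx C' = dsubmx C.

Definition deploy_protected_sensor (R : realType) (nx ny ne : nat)
    (p : 'I_ne.+1) (C : 'M[R]_(ny + ne, nx)) (C' : 'M[R]_(ny + ne.+1, nx)) :=
  usubmx C' = usubmx C /\ row' p (dsubmx C') = dsubmx C.

(* Actuator i of the old system is actuator lift p i of the new one. *)
Definition deploy_actuator (R : realType) (nx nu : nat)
    (p : 'I_nu.+1) (B : 'M[R]_(nx, nu)) (B' : 'M[R]_(nx, nu.+1)) :=
  col' p B' = B.

(* Main.v *)
(* The output equation of the unprotected sensors can be solved for the sensor
   attack, s = - C_u x, so an undetectable attack is an actuator signal u whose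
   state trajectory x satisfies C_e x = 0 for the protected rows C_e, and its
   norm is the number of active actuators plus the number of nonzero rows of
   C_u x. A new unprotected row adds at most one to this number, a new protected
   row only adds a constraint, and an old attack extends to a new actuator by
   leaving the latter idle. *)
Require Import Defs.
From HB Require Import structures.
From mathcomp Require Import all_boot all_order all_algebra.
From mathcomp Require Import boolp constructive_ereal reals.
Set Implicit Arguments.
Unset Strict Implicit.
Unset Printing Implicit Defensive.
Import Order.TTheory GRing.Theory Num.Theory.
Local Open Scope ring_scope.

Section SignalSupport.
Variable R : realType.

(** The body of [attack_support] in arbitrary dimension, so that the actuator and sensor blocks of
    an attack and the outputs [usubmx C *m x k] are all counted alike. *)
Definition signal_support n (f : nat -> 'cV[R]_n) : {set 'I_n} :=
  [set i | `[< exists k : nat, f k i 0 != 0 >]].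

(** Two dimensions are allowed in order to compare an entry of a signal with the matching entry of a
    block, or of the signal with a row deleted. *)
Lemma eq_signal_support m n (f : nat -> 'cV[R]_m) (g : nat -> 'cV[R]_n) j i :
  (forall k, (f k j 0 == 0) = (g k i 0 == 0)) ->
  (j \in signal_support f) = (i \in signal_support g).
Proof.
move=> fg; rewrite !inE; apply: asbool_equiv_eq.
by split=> -[k fk]; exists k; move: fk; rewrite fg.
Qed.

Lemma attack_norm0_split nu ny (a : attack_signal R nu ny) :
  attack_norm0 a = (#|signal_support (fun k => usubmx (a k))| +
                    #|signal_support (fun k => dsubmx (a k))|)%N.
Proof.
rewrite /attack_norm0 -[attack_support a]/(signal_support a).
rewrite -!sum1_card big_mkcond big_split_ord /=.
by congr (_ + _)%N; rewrite [RHS]big_mkcond; apply: eq_bigr => j _;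
  congr (if _ then _ else _); apply: eq_signal_support => k; rewrite mxE.
Qed.

Lemma card_signal_support_row' n (p : 'I_n.+1) (f : nat -> 'cV[R]_n.+1) :
  #|signal_support f| =
  ((p \in signal_support f) + #|signal_support (fun k => row' p (f k))|)%N.
Proof.
rewrite -!sum1_card big_mkcond (bigD1_ord p) //=.
congr (_ + _)%N; rewrite [RHS]big_mkcond; apply: eq_bigr => j _.
by congr (if _ then _ else _); apply: eq_signal_support => k; rewrite mxE.
Qed.

Lemma card_signal_support_opp n (f : nat -> 'cV[R]_n) :
  #|signal_support (fun k => - f k)| = #|signal_support f|.
Proof.
by apply: eq_card => j; apply: eq_signal_support => k; rewrite mxE oppr_eq0.
Qed.

End SignalSupport.

Lemma row'_mulmx (R : pzSemiRingType) m n q p (M : 'M[R]_(m, n)) (N : 'M[R]_(n, q)) :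
  row' p (M *m N) = row' p M *m N.
Proof. by apply/matrixP=> i j; rewrite !mxE; apply: eq_bigr => k _; rewrite mxE. Qed.

(** Used for an actuator [p] that stays idle: its column of the input matrix then contributes
    nothing to the dynamics. *)
Lemma mulmx_col'_row' (R : pzSemiRingType) m n q (p : 'I_n.+1)
    (M : 'M[R]_(m, n.+1)) (N : 'M[R]_(n.+1, q)) :
  row p N = 0 -> M *m N = col' p M *m row' p N.
Proof.
move=> /rowP N0; apply/matrixP=> i j; rewrite !mxE (bigD1_ord p) //=.
have := N0 j; rewrite !mxE => ->; rewrite mulr0 add0r.
by apply: eq_bigr => k _; rewrite !mxE.
Qed.

Section Candidates.
Variables (R : realType) (nx nu ny ne : nat).
Implicit Types (A : 'M[R]_nx) (B : 'M[R]_(nx, nu)) (C : 'M[R]_(ny + ne, nx)).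

Lemma undetectableP A B C (a : attack_signal R nu ny) :
  undetectable A B C a <->
  exists x : nat -> 'cV[R]_nx, x 0%N = 0 /\ forall k,
    [/\ x k.+1 = A *m x k + B *m usubmx (a k),
        dsubmx (a k) = - (usubmx C *m x k)
      & dsubmx C *m x k = 0].
Proof.
have dynE k : Ba ny B *m a k = B *m usubmx (a k).
  by rewrite -{1}[a k]vsubmxK mul_row_col mul0mx addr0.
have outE (z : 'cV_nx) k : C *m z + Da R nu ny ne *m a k =
    col_mx (usubmx C *m z + dsubmx (a k)) (dsubmx C *m z).
  rewrite -{1}[C]vsubmxK -{1}[a k]vsubmxK mul_col_mx mul_block_col.
  by rewrite !mul0mx mul1mx add0r addr0 add_col_mx addr0.
split=> -[x [x0 xP]]; exists x; split=> // k; have := xP k.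
  rewrite dynE outE => -[xS /esym/eqP].
  rewrite -col_mx0 => /eqP/eq_col_mx[su sd]; split=> //.
  by apply/eqP; rewrite -addr_eq0 addrC su.
by rewrite dynE outE => -[xS -> ->]; rewrite subrr col_mx0.
Qed.

(** The sensor attack is determined by the state up to a sign, and a sign does not change a support;
    hence the output itself can be counted. *)
Lemma index_candidateP A B C i n :
  index_candidate A B C i n <->
  exists (u : nat -> 'cV[R]_nu) (x : nat -> 'cV[R]_nx),
    [/\ x 0%N = 0,
        forall k, x k.+1 = A *m x k + B *m u k,
        forall k, dsubmx C *m x k = 0,
        exists k, u k i 0 != 0
      & n = (#|signal_support u| +
             #|signal_support (fun k => usubmx C *m x k)|)%N].
Proof.
split=> [/asboolP[a [/undetectableP[x [x0 xP]] ai <-]]|].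
  exists (fun k => usubmx (a k)), x; split=> // [k|k||]; try by case: (xP k).
    by case: ai => k aki; exists k; rewrite mxE.
  rewrite attack_norm0_split -(card_signal_support_opp (fun k => _ *m x k)).
  congr (_ + _)%N; apply: eq_card => j; apply: eq_signal_support => k.
  by case: (xP k) => _ ->.
case=> u [x [x0 xS xe [k0 ui] ->]]; apply/asboolP.
exists (fun k => col_mx (u k) (- (usubmx C *m x k))); split.
- apply/undetectableP; exists x; split=> // k.
  by rewrite col_mxKu col_mxKd.
- by exists k0; rewrite col_mxEu.
- rewrite attack_norm0_split -(card_signal_support_opp (fun k => _ *m x k)).
  congr (_ + _)%N; apply: eq_card => j; apply: eq_signal_support => k.
    by rewrite col_mxKu.
  by rewrite col_mxKd.
Qed.

End Candidates.

(** Common reduction for all the bounds: a minimal candidate of the first system yields one of the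
    second at extra cost at most [c]. Only the state dimension is shared, so either system may be
    the one after deployment. *)
Lemma security_index_leD (R : realType) nx nu ny ne nu' ny' ne' (c : nat)
    (A : 'M[R]_nx) (B : 'M[R]_(nx, nu)) (C : 'M[R]_(ny + ne, nx)) i
    (B' : 'M[R]_(nx, nu')) (C' : 'M[R]_(ny' + ne', nx)) i' :
  (forall n, index_candidate A B C i n ->
     exists2 m, index_candidate A B' C' i' m & (m <= n + c)%N) ->
  (security_index A B' C' i' <= security_index A B C i + c%:R%:E)%E.
Proof.
move=> cand; rewrite /security_index; case: pselect => [ex'|nex'].
  case: pselect => [ex|_]; last by rewrite addye // leey.
  case: ex_minnP => m' _ m'_min; case: ex_minnP => n n_cand _.
  have [m /m'_min m'm mn] := cand n n_cand.
  by rewrite -EFinD lee_fin -natrD ler_nat (leq_trans m'm).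
(* The index on the left is now infinite; a candidate on the right would be transferred to the left,
   so the right side is infinite too. *)
case: pselect => [[n n_cand]|_]; last by rewrite addye.
by have [m m_cand _] := cand n n_cand; case: nex'; exists m.
Qed.

Theorem proposition2 (R : realType) (nx nu ny ne : nat)
    (A : 'M[R]_nx) (B : 'M[R]_(nx, nu)) (C : 'M[R]_(ny + ne, nx))
    (hB : \rank B = nu) (i : 'I_nu) :
  [/\ (forall (p : 'I_ny.+1) (C' : 'M[R]_(ny.+1 + ne, nx)),
         deploy_unprotected_sensor p C C' ->
         (security_index A B C i <= security_index A B C' i)%E /\
         (security_index A B C' i <= security_index A B C i + 1)%E),
      (forall (p : 'I_ne.+1) (C' : 'M[R]_(ny + ne.+1, nx)),
         deploy_protected_sensor p C C' ->
         (security_index A B C i <= security_index A B C' i)%E)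
    & (forall (p : 'I_nu.+1) (B' : 'M[R]_(nx, nu.+1)),
         deploy_actuator p B B' -> \rank B' = nu.+1 ->
         (security_index A B' C (lift p i) <= security_index A B C i)%E)].
Proof.
have le0 (x y : \bar R) : (x <= y + 0%:R%:E)%E -> (x <= y)%E by rewrite adde0.
split=> [p C' [Cu Cd]|p C' [Cu Cd]|p B' BB' _].
(* Along a fixed trajectory, the two sensor counts differ by a boolean, namely whether the new
   sensor ever reads a nonzero value. Its being at least 0 gives the lower bound, at most 1 the
   upper bound. *)
- have suppC' (x : nat -> 'cV[R]_nx) :
      #|signal_support (fun k => usubmx C' *m x k)| =
      ((p \in signal_support (fun k => usubmx C' *m x k)) +
       #|signal_support (fun k => usubmx C *m x k)|)%N.
    rewrite (card_signal_support_row' p); congr (_ + _)%N.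
    by apply: eq_card => j; apply: eq_signal_support => k; rewrite row'_mulmx Cu.
  split; [apply/le0/security_index_leD => n|apply: (security_index_leD (c := 1)) => n];
    move=> /index_candidateP[u [x [x0 xS xe ui ->]]].
  + exists (#|signal_support u| +
            #|signal_support (fun k => usubmx C *m x k)|)%N.
      by apply/index_candidateP; exists u, x; rewrite -Cd.
    by rewrite addn0 suppC' leq_add2l leq_addl.
  + exists (#|signal_support u| +
            #|signal_support (fun k => usubmx C' *m x k)|)%N.
      by apply/index_candidateP; exists u, x; rewrite Cd.
    by rewrite suppC' -addnA leq_add2l addnC leq_add2l leq_b1.
- apply/le0/security_index_leD => n nP; exists n; last by rewrite addn0.
  case/index_candidateP: nP => u [x [x0 xS xe ui ->]].
  apply/index_candidateP; exists u, x; rewrite -Cu; split=> // k.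
  (* The old protected output is the new one, which vanishes, with row [p] deleted. *)
  by rewrite -Cd -(row'_mulmx p) xe; apply/matrixP=> r s; rewrite !mxE.
- apply/le0/security_index_leD => n nP; exists n; last by rewrite addn0.
  case/index_candidateP: nP => u [x [x0 xS xe [k0 ui] ->]].
  (* Entry [lift p l] is [u k l 0]; the default 0 is taken exactly at [p], where [unlift] gives
     [None], so the new actuator is idle. *)
  pose u' k : 'cV[R]_nu.+1 := \col_j oapp (fun l => u k l 0) 0 (unlift p j).
  have u'p k : row p (u' k) = 0.
    by apply/matrixP=> r s; rewrite !mxE unlift_none.
  have u'E k : row' p (u' k) = u k.
    by apply/matrixP=> r s; rewrite !mxE liftK ord1.
  apply/index_candidateP; exists u', x; split=> //.
  + by move=> k; rewrite (mulmx_col'_row' _ (u'p k)) u'E BB'.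
  + by exists k0; rewrite mxE liftK.
  + congr (_ + _)%N; rewrite (card_signal_support_row' p u').
    have -> : p \in signal_support u' = false.
      by rewrite inE; apply/asboolP=> -[k]; rewrite mxE unlift_none eqxx.
    by apply: eq_card => j; apply: eq_signal_support => k; rewrite u'E.
Qed.
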